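(* Let $n,k\geq 1$ and let ${\bf m}=(m_1,\dots,m_k)$ be an array of nonnegative integers. For every permutation $\tau\in\mathfrak{S}_{k-1}$ there exists a bijection $\Psi_k:\mathcal{A}_n^k({\bf m})\to\mathcal{A}_n^k({\bf m}')$, where ${\bf m}'=(m_{\tau(1)},\dots,m_{\tau(k-1)},m_k)$, such that for every $\mathfrak{a}\in\mathcal{A}_n^k({\bf m})$, $$\bigl(\mathrm{des}(\mathfrak{a}),\mathrm{dez}(\mathfrak{a}),\mathrm{Der}(\mathfrak{a})\bigr)=\bigl(\mathrm{dez}(\Psi_k(\mathfrak{a})),\mathrm{des}(\Psi_k(\mathfrak{a})),\mathrm{Der}(\Psi_k(\mathfrak{a}))\bigr).$$
   Context: $[n]=\{1,\dots,n\}$ and $\mathfrak{S}_n$ is the set of permutations of $[n]$, written in one-line notation; $\mathrm{FIX}(\pi)=\{i:\pi(i)=i\}$. For an integer $k\ge 1$, a $k$-arrangement of $[n]$ is a pair $\mathfrak{a}=(\pi,\phi)$ with $\pi\in\mathfrak{S}_n$ and $\phi:\mathrm{FIX}(\pi)\to\{-1,\dots,-k\}$ an arbitrary function; $\mathcal{A}_n^k$ is the set of them. The positive reduction $\mathrm{red}^+(w)$ of an integer word $w$ replaces every occurrence of the $i$-th smallest positive letter of $w$ by $i$, for all $i$ (negative letters unchanged). The derangement form $\mathrm{df}_k(\mathfrak{a})$ is obtained from $\pi(1)\cdots\pi(n)$ by replacing $\pi(i)$ with $\phi(i)$ for each $i\in\mathrm{FIX}(\pi)$ and then applying positive reduction;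 the permutation form $\mathrm{pf}_k(\mathfrak{a})$ is obtained likewise, but replacing $\pi(i)$ by $\phi(i)$ only for those $i\in\mathrm{FIX}(\pi)$ with $\phi(i)\ne -k$. For an integer word $w=w_1\cdots w_n$, $\mathrm{des}(w)=|\{i\in[n-1]:w_i>w_{i+1}\}|$, and $\mathrm{Pos}(w)$ is the subword of positive letters. For $\mathfrak{a}\in\mathcal{A}_n^k$: $\mathrm{des}(\mathfrak{a})=\mathrm{des}(\mathrm{pf}_k(\mathfrak{a}))$, $\mathrm{dez}(\mathfrak{a})=\mathrm{des}(\mathrm{df}_k(\mathfrak{a}))$, $\mathrm{Der}(\mathfrak{a})=\mathrm{Pos}(\mathrm{df}_k(\mathfrak{a}))$, $\mathrm{fix}_i(\mathfrak{a})=|\{j\in\mathrm{FIX}(\pi):\phi(j)=-i\}|$. For ${\bf m}=(m_1,\dots,m_k)$, $\mathcal{A}_n^k({\bf m})=\{\mathfrak{a}\in\mathcal{A}_n^k:\mathrm{fix}_i(\mathfrak{a})=m_i,\ 1\le i\le k\}$. *)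

(* Defs.v *)
From HB Require Import structures.
From mathcomp Require Import all_boot all_order all_algebra all_fingroup.
Set Implicit Arguments. Unset Strict Implicit. Unset Printing Implicit Defensive.
Import Order.TTheory GRing.Theory Num.Theory.

(* Positions and values of [n] are encoded by 'I_n (0-based). A k-arrangement
   (pi, phi) is encoded as a permutation pi of 'I_n together with a finite
   function phi : 'I_n -> option 'I_k which is None exactly at the non-fixed
   points of pi; phi i = Some j encodes the value -(j+1). *)
Definition arr_wf n k (p : {perm 'I_n} * {ffun 'I_n -> option 'I_k}) : bool :=
  [forall i, (p.1 i == i) == (p.2 i != None)].

Definition arrangement n k :=
  {p : {perm 'I_n} * {ffun 'I_n -> option 'I_k} | arr_wf p}.

Definition arr_pi n k (a : arrangement n k) : {perm 'I_n} := (sval a).1.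
Definition arr_phi n k (a : arrangement n k) : {ffun 'I_n -> option 'I_k} :=
  (sval a).2.

Definition redp (w : seq int) : seq int :=
  [seq if (0 < x)%R then Posz (size (undup [seq y <- w | (0 < y)%R && (y <= x)%R]))
       else x | x <- w].

Definition df n k (a : arrangement n k) : seq int :=
  redp [seq if arr_phi a i is Some j then (- (Posz (j.+1)))%R else Posz (arr_pi a i).+1
       | i <- enum 'I_n].

Definition pf n k (a : arrangement n k) : seq int :=
  redp [seq match arr_phi a i with
            | Some j => if val j != k.-1 then (- (Posz (j.+1)))%R else Posz (arr_pi a i).+1
            | None => Posz (arr_pi a i).+1 end
       | i <- enum 'I_n].

Definition desw (w : seq int) : nat :=
  count (fun p : int * int => (p.2 < p.1)%R) (zip w (behead w)).

Definition Pos (w : seq int) : seq int := [seq x <- w | (0 < x)%R].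

Definition des_a n k (a : arrangement n k) := desw (pf a).
Definition dez_a n k (a : arrangement n k) := desw (df a).
Definition Der_a n k (a : arrangement n k) := Pos (df a).

Definition fixcnt n k (a : arrangement n k) (i : 'I_k) : nat :=
  #|[set j : 'I_n | arr_phi a j == Some i]|.

Definition inA n k (m : 'I_k -> nat) (a : arrangement n k) : Prop :=
  forall i : 'I_k, fixcnt a i = m i.

Definition mprime k (m : 'I_k -> nat) (tau : 'S_(k.-1)) (i : 'I_k) : nat :=
  match (insub (val i) : option 'I_(k.-1)) with
  | Some j => m (widen_ord (leq_pred k) (tau j))
  | None => m i
  end.

(* Main.v *)
Require Import Defs.
From mathcomp Require Import all_boot all_order all_algebra all_fingroup zify.

(* Encode an arrangement by the word obtained from its derangement form by
   marking each positive letter as an excedance (E) or a deficiency (D). With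
   [*] standing for the letter [- k] and [o] for any other negative letter,
   dez is the descent number for [* < o < D < E], and des the one for
   [o < D < * < E]. Cut the word at its positive letters into blocks of negative
   ones. Writing a block containing [*] as [a c b], where [c] runs from its
   first to its last [*], the exchange of [a] and [b] swaps des and dez if
   both neighbours are E (or the ends of the word), and des = dez already if
   both are D. The blocks E..D and D..E alternate, and pairing each of the
   former with the next of the latter one can swap the total des and dez, again
   by exchanging [a] of the first with [b] of the second. All this preserves the
   content and the positive letters. The contents of two consecutive letters
   [- i], [- (i + 1)] with [i + 1 < k] are exchanged by reversing and
   complementing each maximal run of these two letters, which changes neither
   des nor dez. *)

Set Implicit Arguments. Unset Strict Implicit. Unset Printing Implicit Defensive.
Import Order.TTheory GRing.Theory Num.Theory.

(** * Descents and reversal of runs *)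

Section Descents.
Variables (T : Type) (r : T -> T -> bool).

Fixpoint dsc (x : T) (w : seq T) : nat :=
  if w is y :: w' then r x y + dsc y w' else 0.

Lemma dsc_cat x w1 w2 : dsc x (w1 ++ w2) = dsc x w1 + dsc (last x w1) w2.
Proof. by elim: w1 x => //= y w1 IH x; rewrite IH addnA. Qed.

Lemma dsc_rcons x w y : dsc x (rcons w y) = dsc x w + r (last x w) y.
Proof. by rewrite -cats1 dsc_cat /= addn0. Qed.

Variables (A : pred T) (c : T -> T).
Hypothesis cA : forall x, A (c x) = A x.
Hypothesis cK : involutive c.

(* [acc] is the reversed and complemented image of the run being read. *)
Fixpoint revrun (acc w : seq T) : seq T :=
  if w is x :: w' then
    if A x then revrun (c x :: acc) w' else acc ++ x :: revrun [::] w'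
  else acc.

Lemma revrun_cat acc u w : all A u ->
  revrun acc (u ++ w) = revrun (rev (map c u) ++ acc) w.
Proof.
elim: u acc => //= x u IH acc /andP [Ax Au].
by rewrite Ax IH // rev_cons cat_rcons.
Qed.

(** As [c] preserves [A], the second pass meets the same maximal runs and undoes each of them; the
    unfinished run [acc] comes back in reading order. *)
Lemma revrunK_acc acc w : all A acc ->
  revrun [::] (revrun acc w) = rev (map c acc) ++ w.
Proof.
elim: w acc => [|x w IH] acc Aacc /=.
  by rewrite -[acc in LHS]cats0 revrun_cat //= !cats0.
case: ifP => Ax.
  by rewrite IH /= ?cA ?Ax // rev_cons cK cat_rcons.
by rewrite revrun_cat //= Ax IH // cats0.
Qed.

Lemma revrunK w : revrun [::] (revrun [::] w) = w.
Proof. exact: revrunK_acc. Qed.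

(** Letters outside [A] are kept instead of being mapped by [c], but there [P] cannot tell the
    difference. *)
Lemma count_revrun (P : pred T) acc w : {in predC A, forall x, P (c x) = P x} ->
  count P (revrun acc w) = count P acc + count (P \o c) w.
Proof.
move=> Pc; elim: w acc => [|x w IH] acc /=; first by rewrite addn0.
case: ifPn => Ax; first by rewrite IH /=; lia.
by rewrite count_cat /= IH Pc.
Qed.

Lemma pmap_revrun (U : Type) (f : T -> option U) acc w :
  {in A, forall x, f x = None} -> all A acc ->
  pmap f (revrun acc w) = pmap f w.
Proof.
move=> fA; have fnil u : all A u -> pmap f u = [::].
  by elim: u => //= x u IH /andP [Ax /IH]; rewrite fA.
elim: w acc => [|x w IH] acc Aacc /=; first exact: fnil.
case: ifP => Ax; first by rewrite IH /= ?cA ?Ax // fA.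
by rewrite pmap_cat /= IH // fnil.
Qed.

Hypothesis r_in : {in A &, forall x y, r (c x) (c y) = r y x}.
Hypothesis r_left : forall x x' y, A x -> A x' -> ~~ A y -> r x y = r x' y.
Hypothesis r_right : forall x x' y, A x -> A x' -> ~~ A y -> r y x = r y x'.

(** Inside the run, reversal and [c] cancel out by [r_in]; by [r_right] the step from [z] into the
    run does not depend on its first letter. *)
Lemma dsc_rev_map z u : ~~ A z -> all A u -> dsc z (rev (map c u)) = dsc z u.
Proof.
move=> Az; elim: u => // b u IH /= /andP [Ab Au].
rewrite rev_cons dsc_rcons IH //; case: u {IH} Au => [|b' u] /=.
  by rewrite (r_right (x' := b)) ?cA // addn0.
move=> /andP [Ab' Au]; rewrite rev_cons last_rcons r_in //.
by rewrite (r_right (x' := b) (x := b')) //; lia.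
Qed.

Lemma dsc_revrun z acc w : ~~ A z -> all A acc ->
  dsc z (revrun acc w) = dsc z (rev (map c acc) ++ w).
Proof.
elim: w z acc => [|x w IH] z acc Az Aacc /=.
  by rewrite cats0 dsc_rev_map.
case: ifPn => Ax.
  by rewrite IH //= ?cA ?Ax // rev_cons cK cat_rcons.
rewrite !dsc_cat /= IH //= dsc_rev_map //; congr (_ + (nat_of_bool _ + _)).
case: acc Aacc => //= b u /andP [Ab Au].
rewrite rev_cons last_rcons; apply: r_left; rewrite ?cA //.
by elim: u b Ab Au => //= y u IHu b _ /andP [Ay /IHu]; apply.
Qed.

End Descents.

(** * Exchanging the two descent numbers *)

Section Words.
Variable k : nat.

(* A letter is a negative value, or a positive value together with the bit
   telling whether it is an excedance. [None] is a sentinel which marks the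
   start and the end of a word: it is never involved in a descent. *)
Definition pos := option (nat * bool).
Definition tok := ('I_k + pos)%type.

Definition star (i : 'I_k) := val i == k.-1.
Definition is_exc (p : pos) := if p is Some (_, e) then e else true.
(** For unequal bits the values are not consulted: at consecutive positions an excedance followed by
    a deficiency always descends, the opposite never. *)
Definition pos_gt (p q : pos) :=
  match p, q with
  | Some (v, e), Some (v', e') => if e == e' then v' < v else e
  | _, _ => false
  end.

Definition dez_gt (x y : tok) :=
  match x, y with
  | inl i, inl j => i < j
  | inl _, inr _ => false
  | inr p, inl _ => isSome p
  | inr p, inr q => pos_gt p q
  end.

(* In the permutation form a letter [- k] is a fixed point: it lies above the
   deficiencies and below the excedances. *)
Definition des_gt (x y : tok) :=
  match x, y with
  | inl i, inl j => ~~ star j && (star i || (i < j))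
  | inl i, inr q => star i && ~~ is_exc q
  | inr p, inl j => isSome p && (is_exc p || ~~ star j)
  | inr p, inr q => pos_gt p q
  end.

Definition tdez := dsc dez_gt (inr None).
Definition tdes := dsc des_gt (inr None).
Definition posw (w : seq tok) : seq pos :=
  pmap (fun x => if x is inr p then Some p else None) w.
Definition cnt (i : 'I_k) (w : seq tok) := count_mem (inl i) w.

Lemma star_ltn (i j : 'I_k) : star i -> (i < j) = false.
Proof. by rewrite /star => /eqP /= ->; have := ltn_ord j; lia. Qed.

Lemma nstar_ltn (i j : 'I_k) : ~~ star i -> star j -> i < j.
Proof. by rewrite /star => /= ni /eqP ->; have := ltn_ord i; lia. Qed.

(** * Blocks of negative letters between two positive letters *)

Section Block.
Implicit Types (a b c u : seq 'I_k).

Definition nstars a := all (predC star) a.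
Definition core c := if c is x :: c' then star x && star (last x c') else false.

Definition jn a : seq tok := map inl a.

(* Telescopes along a block; hence a block starting and ending with a star has
   as many descents for both orders. *)
Lemma dez_des_block i u :
  dsc dez_gt (inl i) (jn u) + star i = dsc des_gt (inl i) (jn u) + star (last i u).
Proof.
elim: u i => //= j u IH i; have := IH j.
case: (boolP (star i)) => si; case: (boolP (star j)) => sj /=;
  rewrite ?(star_ltn _ si) ?(nstar_ltn si sj) ?si ?sj /=; lia.
Qed.

Lemma dez_des_nstars i u : nstars (i :: u) ->
  dsc dez_gt (inl i) (jn u) = dsc des_gt (inl i) (jn u).
Proof.
move=> nu; have := dez_des_block i u.
have -> : star i = false by case/andP: nu => /negbTE.
have -> : star (last i u) = false by apply/negbTE/(allP nu)/mem_last.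
by rewrite !addn0.
Qed.

Definition inner (r : tok -> tok -> bool) u :=
  if u is i :: u' then dsc r (inl i) (jn u') else 0.

Lemma inner_core c : core c -> inner des_gt c = inner dez_gt c.
Proof.
by case: c => //= i c /andP [si sl]; have := dez_des_block i c; rewrite si sl; lia.
Qed.

Lemma inner_nstars a : nstars a -> inner des_gt a = inner dez_gt a.
Proof. by case: a => // i a /dez_des_nstars. Qed.

Definition slot (r : tok -> tok -> bool) p u q :=
  dsc r (inr p) (rcons (jn u) (inr q)).

Lemma slot_core r p a c b q :
  core c -> exists s s', [/\ star s, star s' &
  slot r p (a ++ c ++ b) q =
    dsc r (inr p) (rcons (jn a) (inl s)) + inner r c
    + dsc r (inl s') (rcons (jn b) (inr q))].
Proof.
case: c => //= s c /andP [ss sl]; exists s, (last s c); split=> //.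
rewrite /slot /jn map_cat /= map_cat rcons_cat dsc_cat /= rcons_cat dsc_cat last_map.
by rewrite !dsc_rcons !addnA.
Qed.

Lemma nstars_last i a : nstars (i :: a) -> star (last i a) = false.
Proof. by move=> /allP /(_ _ (mem_last i a)) /negbTE. Qed.

Lemma dsc_dez_to_star p a s : nstars a -> star s ->
  dsc dez_gt (inr p) (rcons (jn a) (inl s)) = isSome p + inner dez_gt a + (a != [::]).
Proof.
case: a => [_ _|i a] /=; first by rewrite !addn0.
move=> na ss; rewrite dsc_rcons last_map /=.
by rewrite nstar_ltn ?(nstars_last na) // addnA.
Qed.

Lemma dsc_dez_of_star s b q : star s ->
  dsc dez_gt (inl s) (rcons (jn b) (inr q)) = inner dez_gt b.
Proof.
move=> ss; case: b => [|i b] //=.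
by rewrite dsc_rcons last_map /= star_ltn // addn0.
Qed.

Lemma dsc_des_to_star p a s : nstars a -> star s ->
  dsc des_gt (inr p) (rcons (jn a) (inl s))
  = (if is_exc p then isSome p : nat else a != [::]) + inner dez_gt a.
Proof.
move=> na ss; rewrite -inner_nstars //; case: a na => [_|i a na] /=.
  by rewrite ss !addn0 orbF; case: p => [[v []]|].
rewrite dsc_rcons last_map /= ss addn0.
by case/andP: na => /= -> _; rewrite orbT andbT; case: p => [[v []]|].
Qed.

Lemma dsc_des_of_star s b q : nstars b -> star s ->
  dsc des_gt (inl s) (rcons (jn b) (inr q))
  = (if is_exc q then b != [::] : nat else 1) + inner dez_gt b.
Proof.
move=> nb ss; rewrite -inner_nstars //; case: b nb => [_|i b nb] /=.
  by rewrite ss; case: (is_exc q).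
rewrite dsc_rcons last_map /= ss nstars_last //= addn0.
by case/andP: nb => /= -> _; case: (is_exc q).
Qed.

Lemma slot_dez p a c b q : nstars a -> core c ->
  slot dez_gt p (a ++ c ++ b) q
  = isSome p + inner dez_gt a + (a != [::]) + inner dez_gt c + inner dez_gt b.
Proof.
move=> na /(slot_core dez_gt p a b q) [s [s' [ss ss' ->]]].
by rewrite dsc_dez_to_star // dsc_dez_of_star.
Qed.

(** Apart from descents inside the three parts, only emptiness of [a] and [b] matters: that of [a]
    when [p] is a deficiency, that of [b] when [q] is an excedance. In [slot_dez] it is always that
    of [a]. *)
Lemma slot_des p a c b q : nstars a -> core c -> nstars b ->
  slot des_gt p (a ++ c ++ b) q
  = (if is_exc p then isSome p : nat else a != [::]) + inner dez_gt a
    + inner dez_gt c + ((if is_exc q then b != [::] : nat else 1) + inner dez_gt b).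
Proof.
move=> na cc nb; have [s [s' [ss ss' ->]]] := slot_core des_gt p a b q cc.
by rewrite dsc_des_to_star // dsc_des_of_star // inner_core.
Qed.

Lemma slot_dez_nstars p u q : nstars u ->
  slot dez_gt p u q
  = (if u == [::] then pos_gt p q : nat else isSome p) + inner dez_gt u.
Proof.
rewrite /slot; case: u => [|i u] //= nu.
by rewrite dsc_rcons last_map /= addn0.
Qed.

Lemma slot_des_nstars p u q : nstars u -> slot des_gt p u q = slot dez_gt p u q.
Proof.
move=> nu; rewrite slot_dez_nstars // -inner_nstars //.
rewrite /slot; case: u nu => [|i u] //= nu.
rewrite dsc_rcons last_map /= nstars_last // addn0.
by case/andP: nu => /= -> _; rewrite orbT andbT.
Qed.

(* A block with a star is cut as [a ++ c ++ b] where [c] runs from the first to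
   the last star. *)
Definition pre u := take (find star u) u.
Definition suf u := rev (pre (rev u)).
Definition mid u := drop (size (pre u)) (take (size u - size (suf u)) u).

Lemma pre_cat a i t : nstars a -> star i -> pre (a ++ i :: t) = a.
Proof.
move=> na si; rewrite /pre find_cat -[has star a]negbK -all_predC -/(nstars a) na /=.
by rewrite si addn0 take_size_cat.
Qed.

Lemma nstars_rev a : nstars (rev a) = nstars a.
Proof. exact: all_rev. Qed.

Lemma core_rev c : core (rev c) = core c.
Proof.
case: c => // i c; case: (lastP c) => [|c' j]; first by rewrite /rev.
by rewrite rev_cons rev_rcons /= !last_rcons andbC.
Qed.

Lemma pre_core a c b : nstars a -> core c -> pre (a ++ c ++ b) = a.
Proof. by case: c => //= i c na /andP [si _]; apply: pre_cat. Qed.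

Lemma suf_core a c b : nstars b -> core c -> suf (a ++ c ++ b) = b.
Proof.
move=> nb cc; rewrite /suf !rev_cat -catA pre_core ?nstars_rev ?core_rev //.
exact: revK.
Qed.

Lemma mid_core a c b : nstars a -> core c -> nstars b -> mid (a ++ c ++ b) = c.
Proof.
move=> na cc nb; rewrite /mid pre_core // suf_core // !size_cat.
by rewrite addnA addnK catA take_size_cat ?size_cat // drop_size_cat.
Qed.

Lemma block_split u : ~~ nstars u ->
  exists a c b, [/\ u = a ++ c ++ b, nstars a, core c & nstars b].
Proof.
rewrite /nstars all_predC negbK => /split_find [i u1 u2 si nu1].
rewrite cat_rcons; case: (boolP (has star u2)) => [|nu2]; last first.
  by exists u1, [:: i], u2; rewrite /nstars !all_predC nu1 nu2 /= si.
(* The last star is the first one of the reversed remainder. *)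
rewrite -has_rev -[in u1 ++ _](revK u2); move: (rev u2) => v /split_find [j v1 v2 sj nv1].
exists u1, (i :: rcons (rev v2) j), (rev v1).
rewrite /nstars !all_predC has_rev nu1 nv1 /= si last_rcons sj.
by split=> //; rewrite rev_cat rev_rcons /= cat_rcons.
Qed.

Definition flip u := if nstars u then u else suf u ++ mid u ++ pre u.

(* In the two mixed cases the middle part [c] moves to the other block. *)
Definition exch u v :=
  match nstars u, nstars v with
  | true, true => (u, v)
  | true, false => (suf v ++ mid v ++ u, pre v)
  | false, true => (suf u, v ++ mid u ++ pre u)
  | false, false => (suf v ++ mid u ++ suf u, pre v ++ mid v ++ pre u)
  end.

Lemma nstars_core a c b : core c -> nstars (a ++ c ++ b) = false.
Proof.
case: c => // i c /andP [si _]; rewrite /nstars !all_cat /= si.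
by rewrite andbF.
Qed.

Lemma flipE a c b : nstars a -> core c -> nstars b -> flip (a ++ c ++ b) = b ++ c ++ a.
Proof. by move=> *; rewrite /flip nstars_core // pre_core // suf_core // mid_core. Qed.

Lemma flipK : involutive flip.
Proof.
move=> u; have [nu|] := boolP (nstars u); first by rewrite /flip !nu.
by move=> /block_split [a [c [b [-> na cc nb]]]]; rewrite !flipE.
Qed.

(** The two mixed cases of [exch] are inverse to each other; each of the other two is an
    involution. *)
Lemma exchK u v : exch (exch u v).1 (exch u v).2 = (u, v).
Proof.
have [nu|] := boolP (nstars u); have [nv|] := boolP (nstars v).
- by rewrite /exch nu nv /= nu nv.
- move=> /block_split [a [c [b [-> na cc nb]]]].
  by rewrite /exch nu nstars_core // pre_core // suf_core // mid_core //
    nstars_core // na suf_core // mid_core // pre_core.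
- move=> /block_split [a [c [b [-> na cc nb]]]].
  by rewrite /exch nv nstars_core // pre_core // suf_core // mid_core //
    nb nstars_core // suf_core // mid_core // pre_core.
move=> /block_split [a [c [b [-> na cc nb]]]].
move=> /block_split [a' [c' [b' [-> na' cc' nb']]]].
by do ![rewrite nstars_core // | rewrite pre_core // | rewrite suf_core //
       | rewrite mid_core // | rewrite /exch].
Qed.

Lemma count_flip P u : count P (flip u) = count P u.
Proof.
have [nu|] := boolP (nstars u); first by rewrite /flip nu.
move=> /block_split [a [c [b [-> na cc nb]]]].
by rewrite flipE // !count_cat; clear; lia.
Qed.

Lemma count_exch P u v :
  count P (exch u v).1 + count P (exch u v).2 = count P u + count P v.
Proof.
have [nu|] := boolP (nstars u); have [nv|] := boolP (nstars v).
- by rewrite /exch nu nv.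
- move=> /block_split [a [c [b [-> na cc nb]]]].
  rewrite /exch nu nstars_core // pre_core // suf_core // mid_core // !count_cat /=.
  by clear; lia.
- move=> /block_split [a [c [b [-> na cc nb]]]].
  rewrite /exch nv nstars_core // pre_core // suf_core // mid_core // !count_cat /=.
  by clear; lia.
move=> /block_split [a [c [b [-> na cc nb]]]].
move=> /block_split [a' [c' [b' [-> na' cc' nb']]]].
rewrite /exch !nstars_core // !pre_core // !suf_core // !mid_core // !count_cat /=.
by clear; lia.
Qed.

Arguments exch : simpl never.

(** The border terms are [isSome p + (a != [::])] for dez and [isSome p + (b != [::])] for des, so
    exchanging [a] and [b] matches them. *)
Lemma slot_flip p u q : is_exc p -> is_exc q ->
  slot des_gt p (flip u) q = slot dez_gt p u q.
Proof.
move=> ep eq; have [nu|] := boolP (nstars u).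
  by rewrite /flip nu slot_des_nstars.
move=> /block_split [a [c [b [-> na cc nb]]]].
by rewrite flipE // slot_des // slot_dez // ep eq; clear; lia.
Qed.

(** In a block with a star, the border terms are [1 + (a != [::])] for both orders. *)
Lemma slot_def p u q : ~~ is_exc p -> ~~ is_exc q ->
  slot des_gt p u q = slot dez_gt p u q.
Proof.
move=> ep eq; have [nu|] := boolP (nstars u); first by rewrite slot_des_nstars.
move=> /block_split [a [c [b [-> na cc nb]]]].
rewrite slot_des // slot_dez // (negbTE ep) (negbTE eq).
have -> : isSome p by case: p ep.
by clear; lia.
Qed.

(** If both blocks have a star, the des border terms of the first slot are [isSome p + 1] whatever
    its parts, while the second slot counts both its outer parts. These become [pre v] and [pre u],
    the very parts counted by dez in the two slots. *)
Lemma slot_exch p q p' q' u v :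
  is_exc p -> ~~ is_exc q -> ~~ is_exc p' -> is_exc q' ->
  slot des_gt p (exch u v).1 q + slot des_gt p' (exch u v).2 q'
  = slot dez_gt p u q + slot dez_gt p' v q'.
Proof.
move=> ep eq ep' eq'.
(* These comparisons matter for empty blocks, where the two positive letters meet. *)
have pq : pos_gt p q = isSome p by case: p q ep eq => [[x []]|] [[y []]|].
have pq' : pos_gt p' q' = false by case: p' q' ep' eq' => [[x []]|] [[y []]|].
have sp' : isSome p' by case: p' ep' {pq'}.
have [nu|] := boolP (nstars u); have [nv|] := boolP (nstars v).
- by rewrite /exch nu nv /= !slot_des_nstars.
- move=> /block_split [a [c [b [-> na cc nb]]]].
  rewrite /exch nu nstars_core // pre_core // suf_core // mid_core //=.
  rewrite slot_des // slot_des_nstars // slot_dez // !slot_dez_nstars //.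
  rewrite ep (negbTE eq) pq pq' sp'.
  by case: (u == [::]); case: (a == [::]); clear; lia.
- move=> /block_split [a [c [b [-> na cc nb]]]].
  rewrite /exch nv nstars_core // pre_core // suf_core // mid_core //=.
  rewrite slot_des // slot_des_nstars // slot_dez // !slot_dez_nstars //.
  rewrite (negbTE ep') eq' pq pq' sp'.
  by case: (b == [::]); case: (v == [::]); clear; lia.
move=> /block_split [a [c [b [-> na cc nb]]]].
move=> /block_split [a' [c' [b' [-> na' cc' nb']]]].
rewrite /exch !nstars_core // !pre_core // !suf_core // !mid_core //=.
by rewrite !slot_des // !slot_dez // ep (negbTE eq) (negbTE ep') eq' sp'; clear; lia.
Qed.

End Block.

(** * Words as sequences of blocks, and the exchange of des and dez on them *)

Fixpoint unparse (l : seq (seq 'I_k * pos)) : seq tok :=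
  if l is (u, p) :: l' then rcons (jn u) (inr p) ++ unparse l' else [::].

Fixpoint parse (acc : seq 'I_k) (w : seq tok) :=
  match w with
  | [::] => [::]
  | inl i :: w' => parse (rcons acc i) w'
  | inr p :: w' => (acc, p) :: parse [::] w'
  end.

Lemma parse_unparse l : parse [::] (unparse l) = l.
Proof.
elim: l => //= [[u p] l IH].
have H acc : parse acc (rcons (jn u) (inr p) ++ unparse l) = (acc ++ u, p) :: l.
  elim: u acc => /= [|i u IHu] acc; first by rewrite IH cats0.
  by rewrite IHu cat_rcons.
exact: H.
Qed.

(** [parse] drops a last block that no positive letter closes, hence the final [inr p]; for whole
    words the sentinel takes this place. *)
Lemma unparse_parse acc w p :
  unparse (parse acc (rcons w (inr p))) = jn acc ++ rcons w (inr p).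
Proof.
elim: w acc => [|[i|q] w IH] acc /=; first by rewrite cats0 cats1.
- by rewrite IH /jn map_rcons cat_rcons.
by rewrite IH /= cat_rcons.
Qed.

(* Each slot that enters a run of deficiencies is paired with the slot that
   leaves it; [st] holds the block of the former while the run is read. *)
Fixpoint swapdes (st : option (seq 'I_k)) (l : seq (seq 'I_k * pos)) :=
  match l with
  | [::] => (odflt [::] st, [::])
  | (u, p) :: l' =>
    match st, is_exc p with
    | None, true => ([::], (flip u, p) :: (swapdes None l').2)
    | None, false =>
      let r := swapdes (Some u) l' in ([::], (r.1, p) :: r.2)
    | Some u0, true =>
      let e := exch u0 u in (e.1, (e.2, p) :: (swapdes None l').2)
    | Some u0, false =>
      let r := swapdes (Some u0) l' in (r.1, (u, p) :: r.2)
    end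
  end.

(** Positive letters do not change, so the second pass pairs the same slots; the block handed back
    by the first pass is the pending block of the second. *)
Lemma swapdesK_st l :
  (swapdes None (swapdes None l).2).2 = l /\
  forall u0, swapdes (Some (swapdes (Some u0) l).1) (swapdes (Some u0) l).2 = (u0, l).
Proof.
elim: l => //= [[u p] l [IH1 IH2]]; case E: (is_exc p) => /=; rewrite E; split.
- by rewrite flipK IH1.
- move=> u0; by rewrite exchK IH1.
- by rewrite IH2.
by move=> u0; rewrite IH2.
Qed.

Lemma map_swapdes st l : map snd (swapdes st l).2 = map snd l.
Proof.
by elim: l st => //= [[u p] l IH] [u0|]; case: (is_exc p) => /=; rewrite IH.
Qed.

Lemma swapdes1 l : (swapdes None l).1 = [::].
Proof. by case: l => //= [[u p] l]; case: ifP. Qed.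

Lemma count_swapdes P st l :
  count P (swapdes st l).1 + count P (flatten (map fst (swapdes st l).2))
  = count P (odflt [::] st) + count P (flatten (map fst l)).
Proof.
elim: l st => // -[u p] l IH [u0|] /=; case: (is_exc p) => /=; rewrite !count_cat.
- by have := IH None; have := count_exch P u0 u; rewrite swapdes1 /=; clear; lia.
- by have := IH (Some u0) => /=; clear; lia.
- by have := IH None; rewrite count_flip swapdes1 /=; clear; lia.
by have := IH (Some u) => /=; clear; lia.
Qed.

Lemma dsc_unparse r p u q l :
  dsc r (inr p) (unparse ((u, q) :: l)) = slot r p u q + dsc r (inr q) (unparse l).
Proof. by rewrite /= dsc_cat last_rcons. Qed.

(** The second clause adds the pending slot from [p] to [q], whose new block is known only when the
    run of deficiencies ends. The condition on the last letter makes every run end. *)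
Lemma des_swapdes_st l :
  (forall p, is_exc p -> is_exc (last p (map snd l)) ->
     dsc des_gt (inr p) (unparse (swapdes None l).2) = dsc dez_gt (inr p) (unparse l))
  /\
  (forall p q p' u0, is_exc p -> ~~ is_exc q -> ~~ is_exc p' ->
     is_exc (last p' (map snd l)) ->
     slot des_gt p (swapdes (Some u0) l).1 q
       + dsc des_gt (inr p') (unparse (swapdes (Some u0) l).2)
     = slot dez_gt p u0 q + dsc dez_gt (inr p') (unparse l)).
Proof.
elim: l => [|[u q'] l [IH1 IH2]].
  by split=> // p q p' u0 _ _ /negbTE /= ->.
split=> [p ep|p q p' u0 ep eq ep'] elast; case: (boolP (is_exc q')) => eq'.
- have -> : (swapdes None ((u, q') :: l)).2 = (flip u, q') :: (swapdes None l).2.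
    by rewrite /= eq'.
  by rewrite !dsc_unparse IH1 // slot_flip.
- have -> : (swapdes None ((u, q') :: l)).2
            = ((swapdes (Some u) l).1, q') :: (swapdes (Some u) l).2.
    by rewrite /= (negbTE eq').
  by rewrite !dsc_unparse; apply: IH2.
- have -> : swapdes (Some u0) ((u, q') :: l)
            = ((exch u0 u).1, ((exch u0 u).2, q') :: (swapdes None l).2).
    by rewrite /= eq'.
  by rewrite !dsc_unparse IH1 // !addnA slot_exch.
have -> : swapdes (Some u0) ((u, q') :: l)
          = ((swapdes (Some u0) l).1, (u, q') :: (swapdes (Some u0) l).2).
  by rewrite /= (negbTE eq').
(* A block between two deficiencies stays in place and has equal des and dez. *)
rewrite !dsc_unparse (slot_def (p := p')) //.
by rewrite addnCA [RHS]addnCA; congr (_ + _); apply: IH2.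
Qed.

Lemma posw_cat w1 w2 : posw (w1 ++ w2) = posw w1 ++ posw w2.
Proof. exact: pmap_cat. Qed.

Lemma posw_rcons w p : posw (rcons w (inr p)) = rcons (posw w) p.
Proof. by rewrite -cats1 posw_cat cats1. Qed.

Lemma posw_jn u : posw (jn u) = [::].
Proof. by elim: u. Qed.

Lemma posw_unparse l : posw (unparse l) = map snd l.
Proof.
by elim: l => //= [[u p] l IH]; rewrite posw_cat -cats1 posw_cat posw_jn IH.
Qed.

Definition neg_pred (P : pred 'I_k) : pred tok :=
  fun x => if x is inl i then P i else false.

Lemma count_unparse P l : count (neg_pred P) (unparse l) = count P (flatten (map fst l)).
Proof.
elim: l => //= [[u p] l IH]; rewrite !count_cat IH -cats1 count_cat /= !addn0.
by rewrite count_map.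
Qed.

Lemma size_posw w : size w = size (posw w) + count (neg_pred predT) w.
Proof. by elim: w => //= [[i|p] w]; rewrite /posw /=; lia. Qed.

Definition swapw (w : seq tok) : seq tok :=
  take (size w) (unparse (swapdes None (parse [::] (rcons w (inr None)))).2).

Lemma swapw_neg P l w : unparse l = w ->
  count (neg_pred P) (unparse (swapdes None l).2) = count (neg_pred P) w.
Proof.
by move=> <-; rewrite !count_unparse; have := count_swapdes P None l; rewrite swapdes1.
Qed.

Lemma unparse_last l s p :
  map snd l = rcons s p -> exists v, unparse l = rcons v (inr p).
Proof.
case: (lastP l) => [|l' [u q]]; first by case: s.
rewrite map_rcons => /rcons_inj [_ /= ->].
elim: l' => [|[u' p'] l' [v IH]] /=; first by exists (jn u); rewrite cats0.
by exists (rcons (jn u') (inr p') ++ v); rewrite IH rcons_cat.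
Qed.

(** The exchange keeps the number of letters and the final sentinel, so the [take] in [swapw]
    removes exactly that sentinel. *)
Lemma unparse_swapw w :
  unparse (swapdes None (parse [::] (rcons w (inr None)))).2 = rcons (swapw w) (inr None).
Proof.
have pK : _ = rcons w (inr None) := unparse_parse [::] w None.
rewrite /swapw; set l := parse _ _ in pK *; set v := unparse _.
have pv : posw v = rcons (posw w) None.
  by rewrite posw_unparse map_swapdes -posw_unparse pK posw_rcons.
have sv : size v = (size w).+1.
  rewrite size_posw pv (swapw_neg _ pK) size_rcons -[rcons w _]cats1 count_cat /= !addn0.
  by rewrite [size w]size_posw addSn.
have [v' Ev] : exists v', v = rcons v' (inr None).
  by apply: unparse_last; rewrite -posw_unparse; exact: pv.
move: sv; rewrite Ev size_rcons => -[<-].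
by rewrite -[in take _ _]cats1 take_size_cat.
Qed.

Lemma swapwK : involutive swapw.
Proof.
move=> w; have := unparse_swapw (swapw w); rewrite -(unparse_swapw w) parse_unparse.
rewrite (swapdesK_st _).1 unparse_parse /=.
by move=> /rcons_inj [].
Qed.

Lemma posw_swapw w : posw (swapw w) = posw w.
Proof.
have : rcons (posw (swapw w)) None = rcons (posw w) None.
  rewrite -!posw_rcons -unparse_swapw posw_unparse map_swapdes -posw_unparse.
  by rewrite unparse_parse.
by move=> /rcons_inj [].
Qed.

Lemma neg_swapw P w : count (neg_pred P) (swapw w) = count (neg_pred P) w.
Proof.
have cr v : count (neg_pred P) (rcons v (inr None)) = count (neg_pred P) v.
  by rewrite -cats1 count_cat /= !addn0.
by rewrite -cr -unparse_swapw (swapw_neg _ (unparse_parse _ _ _)) cr.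
Qed.

Lemma size_swapw w : size (swapw w) = size w.
Proof. by rewrite !size_posw posw_swapw neg_swapw. Qed.

Lemma cnt_swapw i w : cnt i (swapw w) = cnt i w.
Proof.
have E : pred1 (inl i) =1 neg_pred (pred1 i) by case.
by rewrite /cnt !(eq_count E) neg_swapw.
Qed.

Lemma des_swapw w : tdes (swapw w) = tdez w.
Proof.
have nodes (r : tok -> tok -> bool) v : (forall x, r x (inr None) = false) ->
    dsc r (inr None) (rcons v (inr None)) = dsc r (inr None) v.
  by move=> r0; rewrite dsc_rcons r0 addn0.
have des0 x : des_gt x (inr None) = false by case: x => [i|[[]|]]; rewrite //= andbF.
have dez0 x : dez_gt x (inr None) = false by case: x => [i|[[]|]].
rewrite /tdes /tdez -(nodes des_gt) // -(nodes dez_gt) // -unparse_swapw.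
rewrite (des_swapdes_st _).1 ?unparse_parse //.
by rewrite -posw_unparse unparse_parse posw_rcons last_rcons.
Qed.

Lemma dez_swapw w : tdez (swapw w) = tdes w.
Proof. by rewrite -des_swapw swapwK. Qed.

(** * Permuting the contents *)

Definition relabel (tau : 'S_k.-1) (i : 'I_k) : 'I_k :=
  if insub (val i) is Some j then widen_ord (leq_pred k) (tau j) else i.

(** This property is stable under products, which reduces it to adjacent transpositions. Both
    descent numbers are kept here; exchanging them is left to [swapw]. *)
Definition relabels (tau : 'S_k.-1) := exists F : seq tok -> seq tok,
  [/\ bijective F,
      forall w, size (F w) = size w /\ posw (F w) = posw w,
      forall i w, cnt i (F w) = cnt (relabel tau i) w
    & forall w, tdez (F w) = tdez w /\ tdes (F w) = tdes w].

Lemma relabelM s t i : relabel (s * t)%g i = relabel t (relabel s i).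
Proof.
rewrite /relabel; case: insubP => [j lj Ej|/negbTE ni]; last by rewrite insubF.
rewrite permM; case: insubP => [j' lj' Ej'|]; last by rewrite /= ltn_ord.
by congr (widen_ord _ (t _)); apply: val_inj; rewrite Ej'.
Qed.

Lemma relabel1 i : relabel 1%g i = i.
Proof.
rewrite /relabel; case: insubP => // j lj Ej.
by rewrite perm1; apply: val_inj.
Qed.

Lemma relabelsM s t : relabels s -> relabels t -> relabels (s * t)%g.
Proof.
(* [F] is applied last, so an index is relabelled by [s] first, in accordance with [relabelM]. *)
move=> [F [bF zF cF dF]] [G [bG zG cG dG]]; exists (F \o G); split=> [|w|i w|w] /=.
- exact: bij_comp.
- by have [-> ->] := zF (G w); apply: zG.
- by rewrite cF cG relabelM.
by have [-> ->] := dF (G w); apply: dG.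
Qed.

Lemma relabels1 : relabels 1%g.
Proof. by exists id; split=> // [|i w]; [exists id | rewrite relabel1]. Qed.

Lemma relabels_adj (a b : 'I_k.-1) : val b = (val a).+1 -> relabels (tperm a b).
Proof.
move=> Eb; set i := widen_ord (leq_pred k) a; set j := widen_ord (leq_pred k) b.
pose A (x : tok) := if x is inl l then (l == i) || (l == j) else false.
pose c (x : tok) : tok := if x is inl l then inl (tperm i j l) else x.
have cA x : A (c x) = A x.
  case: x => //= l; case: tpermP => [->|->|/eqP/negbTE -> /eqP/negbTE ->] //;
    by rewrite !eqxx ?orbT.
have cK : involutive c by case=> //= l; rewrite tpermK.
have Eij : val j = (val i).+1 by [].
have nsi : star i = false by rewrite /star /=; have := ltn_ord a; lia.
have nsj : star j = false by rewrite /star /=; have := ltn_ord b; lia.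
have ij : (i == j) = false by rewrite -val_eqE Eij ltn_eqF.
have nAl (l : 'I_k) : ~~ A (inl l) -> val l != val i /\ val l != val j.
  by rewrite /= negb_or => /andP [].
exists (revrun A c [::]); split.
- by exists (revrun A c [::]); apply: revrunK.
- move=> w; split; last by apply: pmap_revrun => //; case.
  by rewrite -[LHS]count_predT count_revrun // -[RHS]count_predT.
- move=> l w; rewrite /cnt count_revrun /= ?add0n; last first.
    case=> [l'|p] //; rewrite !inE /= negb_or => /andP [li lj].
    by rewrite tpermD // eq_sym.
  have -> : relabel (tperm a b) l = tperm i j l.
    rewrite /relabel; case: insubP => [l' ll' El'|nl].
      have -> : l = widen_ord (leq_pred k) l' by apply: val_inj.
      rewrite (inj_tperm (f := widen_ord (leq_pred k))) //.
      by move=> x y /(congr1 val) /= /val_inj.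
    rewrite tpermD //; apply/eqP => El; move: nl; rewrite -El /= ltn_ord //.
  apply: eq_count => -[l'|p] //=.
  by apply/eqP/eqP => -[] H; [rewrite -H tpermK|rewrite H tpermK].
have main r : 
    {in A &, forall x y, r (c x) (c y) = r y x} ->
    (forall x x' y, A x -> A x' -> ~~ A y -> r x y = r x' y) ->
    (forall x x' y, A x -> A x' -> ~~ A y -> r y x = r y x') ->
    forall w, dsc r (inr None) (revrun A c [::] w) = dsc r (inr None) w.
  by move=> r_in rl rr w; rewrite (@dsc_revrun _ r A c).
have tij : tperm i j i = j by rewrite tpermL.
have tji : tperm i j j = i by rewrite tpermR.
have AP x : x \in A -> x = inl i \/ x = inl j.
  by case: x => // l /orP [] /eqP ->; [left | right].
(* No index lies strictly between those of [i] and [j]. *)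
have ltl l : ~~ A (inl l) -> (i < l) = (j < l).
  by move=> /nAl [] /=; rewrite (Eb : b = a.+1 :> nat); clear; lia.
have ltr l : ~~ A (inl l) -> (l < i) = (l < j).
  by move=> /nAl [] /=; rewrite (Eb : b = a.+1 :> nat); clear; lia.
move=> w; split; apply: main.
- by move=> x y /AP [] -> /AP [] ->; rewrite /= ?tij ?tji ?ltnn.
- by move=> x x' [l|p] /AP [] -> /AP [] -> //= /ltl; rewrite /= => ->.
- by move=> x x' [l|p] /AP [] -> /AP [] -> //= /ltr; rewrite /= => ->.
- by move=> x y /AP [] -> /AP [] ->; rewrite /= ?tij ?tji ?nsi ?nsj ?ltnn.
- by move=> x x' [l|p] /AP [] -> /AP [] ->; rewrite /= ?nsi ?nsj //= => /ltl /= ->.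
by move=> x x' [l|p] /AP [] -> /AP [] ->; rewrite /= ?nsi ?nsj //= => /ltr /= ->.
Qed.

Lemma relabels_tperm (a b : 'I_k.-1) : relabels (tperm a b).
Proof.
wlog ab : a b / a < b.
  move=> H; case: (ltngtP a b) => [/H //|/H|/val_inj ->]; first by rewrite tpermC.
  by rewrite tperm1; apply: relabels1.
move Ed: (b - a.+1) => d; elim: d b ab Ed => [|d IH] b ab Ed.
  by apply: relabels_adj => /=; lia.
have lb' : b.-1 < k.-1 by have := ltn_ord b; lia.
pose b' := Ordinal lb'.
have H1 : relabels (tperm a b') by apply: IH => /=; lia.
have H2 : relabels (tperm b' b) by apply: relabels_adj => /=; lia.
(* Conjugation by [tperm b' b] carries [b'] to [b] and fixes [a]. *)
have -> : tperm a b = (tperm b' b * tperm a b' * tperm b' b)%g.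
  rewrite -[X in (X * _ * _)%g]tpermV -mulgA -conjgE tpermJ tpermL tpermD //;
    by apply/eqP => /(congr1 val) /=; lia.
exact: relabelsM (relabelsM H2 H1) H2.
Qed.

Lemma relabelsP tau : relabels tau.
Proof.
have [ts -> _] := prod_tpermP tau.
by elim/big_rec: _ => [|t s _]; [apply: relabels1|apply/relabelsM/relabels_tperm].
Qed.

Lemma swapping_bijection (tau : 'S_k.-1) : exists F : seq tok -> seq tok,
  [/\ bijective F,
      forall w, size (F w) = size w /\ posw (F w) = posw w,
      forall i w, cnt i (F w) = cnt (relabel tau i) w
    & forall w, tdez (F w) = tdes w /\ tdes (F w) = tdez w].
Proof.
have [F [bF zF cF dF]] := relabelsP tau; exists (swapw \o F).
split=> [|w|i w|w] /=.
- by apply: bij_comp => //; exists swapw; apply: swapwK.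
- by rewrite size_swapw posw_swapw; apply: zF.
- by rewrite cnt_swapw cF.
by rewrite dez_swapw des_swapw; have [-> ->] := dF w.
Qed.

End Words.

(** * Arrangements as words *)

Definition gtz (x y : int) : bool := (y < x)%R.

Lemma desw_cons x w : desw (x :: w) = dsc gtz x w.
Proof.
rewrite /desw; elim: w x => // y w IH x.
by have := IH y => /= ->.
Qed.

Lemma desw_map (f : int -> int) w :
  {in w &, forall x y, (f x < f y)%R = (x < y)%R} -> desw (map f w) = desw w.
Proof.
case: w => // x w; rewrite /= !desw_cons; elim: w x => // y w IH x fw /=.
rewrite IH => [|u v uw vw]; last by apply: fw; rewrite inE ?uw ?vw orbT.
by rewrite /gtz fw // !inE eqxx ?orbT.
Qed.

(** Reduction preserves signs and is strictly increasing on the letters of [w]. *)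
Lemma desw_redp w : desw (redp w) = desw w.
Proof.
rewrite /redp; set f := fun x => _; apply: desw_map.
pose S x := [seq y <- w | (0 < y)%R && (y <= x)%R].
have fpos x : (0 < x)%R -> f x = Posz (size (undup (S x))) by rewrite /f => ->.
have fneg x : (x <= 0)%R -> f x = x by rewrite /f ltNge => ->.
have fgt0 x : x \in w -> (0 < x)%R -> (0 < f x)%R.
  move=> xw x0; rewrite fpos // ltz_nat -has_predT; apply/hasP; exists x => //.
  by rewrite mem_undup mem_filter x0 lexx xw.
have fle x y : (0 < x)%R -> (x <= y)%R -> (f x <= f y)%R.
  move=> x0 xy; rewrite !fpos ?(lt_le_trans x0) // lez_nat.
  apply: uniq_leq_size (undup_uniq _) _ => z; rewrite !mem_undup !mem_filter.
  by move=> /andP [/andP [-> zx] ->]; rewrite (le_trans zx).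
have flt x y : y \in w -> (0 < x)%R -> (x < y)%R -> (f x < f y)%R.
  move=> yw x0 xy; have y0 := lt_trans x0 xy; rewrite !fpos // ltz_nat.
  have ny : y \notin undup (S x).
    by rewrite mem_undup mem_filter leNgt xy andbF.
  (* The letter [y] counts in its own rank but not in that of [x]. *)
  apply: (@uniq_leq_size _ (y :: undup (S x))) => [|z]; first by rewrite /= ny undup_uniq.
  rewrite inE !mem_undup !mem_filter => /predU1P [->|]; first by rewrite y0 lexx yw.
  by move=> /andP [/andP [-> zx] ->]; rewrite (le_trans zx (ltW xy)).
move=> x y xw yw; case: (ltP 0%R x) => x0; case: (ltP 0%R y) => y0.
- case: (ltP x y) => xy; first by rewrite flt.
  by apply/negbTE; rewrite -leNgt fle.
- rewrite (fneg y) // (lt_gtF (le_lt_trans y0 (fgt0 x xw x0))).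
  by rewrite (lt_gtF (le_lt_trans y0 x0)).
- by rewrite (fneg x) // (le_lt_trans x0 (fgt0 y yw y0)) (le_lt_trans x0 y0).
by rewrite !fneg.
Qed.

Lemma Pos_redp w : Pos (redp w) = redp (Pos w).
Proof.
rewrite /redp /Pos filter_map; set p := preim _ _.
have -> : filter p w = [seq x <- w | (0 < x)%R].
  apply: eq_in_filter => x xw; rewrite /p /=; case: ifP => [x0|->] //.
  rewrite ltz_nat -has_predT; apply/hasP; exists x => //.
  by rewrite mem_undup mem_filter x0 lexx xw.
apply: eq_map => x; congr (if _ then Posz (size (undup _)) else _).
by rewrite -filter_predI; apply: eq_filter => y /=; rewrite andbAC andbb.
Qed.

Lemma redp_map (T : eqType) (h : T -> int) (s : seq T) :
  uniq (map h s) -> (forall x, 0 < h x)%R ->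
  redp (map h s) = [seq Posz (count (fun y => h y <= h x)%R s) | x <- s].
Proof.
move=> us h0; rewrite /redp -map_comp; apply: eq_map => x /=; rewrite h0.
rewrite undup_id ?filter_uniq // size_filter count_map.
by congr Posz; apply: eq_count => y /=; rewrite h0.
Qed.

(** Agreement is required at consecutive positions only: elsewhere the order of the tokens need not
    reflect that of the values. *)
Lemma desw_enum (T : Type) (r : T -> T -> bool) (z : T) n
    (F : 'I_n -> int) (G : 'I_n -> T) :
  (forall i, r z (G i) = false) ->
  (forall i j : 'I_n, val j = i.+1 -> (F j < F i)%R = r (G i) (G j)) ->
  desw (map F (enum 'I_n)) = dsc r z (map G (enum 'I_n)).
Proof.
move=> rz rFG; have: sorted (fun i j : 'I_n => val j == (val i).+1) (enum 'I_n).
  rewrite -(sorted_map (f := val) (e' := fun i j => j == i.+1)) val_enum_ord.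
  by case: (n) => // m; elim: m 0 => //= m IH s; rewrite eqxx IH.
case: (enum 'I_n) => // i s; rewrite /= desw_cons rz add0n.
elim: s i => //= j s IH i /andP [/eqP ij js].
by rewrite IH // /gtz (rFG i j).
Qed.

Lemma ltn_index_filter_enum n (P : pred 'I_n) (s := [seq i <- enum 'I_n | P i]) x y :
  x \in s -> y \in s -> (index x s < index y s) = (x < y).
Proof.
have so : sorted (fun i j : 'I_n => i < j) s.
  apply: sorted_filter => [? ? ?|]; first exact: ltn_trans.
  by rewrite -(sorted_map (f := val) (e' := ltn)) val_enum_ord iota_ltn_sorted.
have tr : transitive (fun i j : 'I_n => i < j) by move=> ? ? ?; apply: ltn_trans.
have H := sorted_ltn_index tr so.
move=> xs ys; apply/idP/idP; first exact: H.
case: (ltngtP (index x s) (index y s)) => // [|/index_inj ->] //; last by rewrite ltnn.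
by move=> /(H _ _ ys xs); lia.
Qed.

Section Arr.
Variables n k : nat.
Implicit Types (a b : arrangement n k) (i j : 'I_n).

Definition nonfix a := [seq i <- enum 'I_n | arr_phi a i == None].

(** The permutation maps its nonfixed points onto themselves, so the index in [nonfix a] is the
    reduced value, counted from 0. *)
Definition letter a i : tok k :=
  if arr_phi a i is Some l then inl l
  else inr (Some (index (arr_pi a i) (nonfix a), i < arr_pi a i)).

Definition word a := map (letter a) (enum 'I_n).

Lemma phi_None a i : (arr_phi a i == None) = (arr_pi a i != i).
Proof.
have := valP a; rewrite /arr_wf => /forallP /(_ i) /eqP.
by rewrite /arr_pi /arr_phi; case: (_ == None); case: (_ == _).
Qed.

Lemma pi_fix a i l : arr_phi a i = Some l -> arr_pi a i = i.
Proof. by have := phi_None a i; case: (arr_phi a i) => // ?; move/esym/negbFE/eqP. Qed.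

Lemma pi_nonfix a i : arr_phi a i = None -> arr_pi a i != i.
Proof. by rewrite -phi_None => ->. Qed.

Lemma mem_nonfix a i : (i \in nonfix a) = (arr_phi a i == None).
Proof. by rewrite mem_filter mem_enum andbT. Qed.

Lemma ltn_index_nonfix a i j : i \in nonfix a -> j \in nonfix a ->
  (index i (nonfix a) < index j (nonfix a)) = (i < j).
Proof. exact: ltn_index_filter_enum. Qed.

Lemma pi_mem_nonfix a i : arr_phi a i = None -> arr_pi a i \in nonfix a.
Proof. by move=> /pi_nonfix; rewrite mem_nonfix phi_None (inj_eq perm_inj). Qed.

Lemma nonfix_uniq a : uniq (nonfix a).
Proof. by rewrite filter_uniq ?enum_uniq. Qed.

Lemma size_word a : size (word a) = n.
Proof. by rewrite size_map size_enum_ord. Qed.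

Lemma fixcnt_word a l : fixcnt a l = cnt l (word a).
Proof.
rewrite /fixcnt /cnt /word cardsE cardE {1}/enum_mem size_filter enumT count_map.
apply: eq_count => i /=; rewrite /letter unfold_in.
by case: (arr_phi a i) => [l'|]; rewrite ?eqE.
Qed.

(** An excedance has a value above its position and a deficiency one below, so at consecutive
    positions unequal bits decide the comparison; for equal bits ranks compare as values. *)
Lemma pos_gt_letter a i j : val j = i.+1 ->
  arr_phi a i = None -> arr_phi a j = None ->
  dez_gt (letter a i) (letter a j) = (arr_pi a j < arr_pi a i).
Proof.
move=> ij fi fj; rewrite /letter fi fj /=.
have := pi_nonfix fi; have := pi_nonfix fj; rewrite -!val_eqE /= => ni nj.
move: (ij : j = i.+1 :> nat) => {}ij; rewrite ij in nj *.
rewrite ltn_index_nonfix ?pi_mem_nonfix //.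
case: (ltnP i) => ni'; case: (ltnP i.+1) => nj' //=.
  by apply/esym; lia.
by apply/esym/negbTE; rewrite -leqNgt; lia.
Qed.

Lemma dez_word a : dez_a a = tdez (word a).
Proof.
rewrite /dez_a /df desw_redp /tdez /word.
apply: desw_enum => [i|i j ij]; first by rewrite /letter; case: (arr_phi a i).
case fi: (arr_phi a i) => [l|]; case fj: (arr_phi a j) => [l'|].
- by rewrite /letter fi fj /=; lia.
- by rewrite /letter fi fj /=; lia.
- by rewrite /letter fi fj /=; lia.
by rewrite pos_gt_letter //; lia.
Qed.

Lemma des_word a : des_a a = tdes (word a).
Proof.
rewrite /des_a /pf desw_redp /tdes /word.
apply: desw_enum => [i|i j ij]; first by rewrite /letter; case: (arr_phi a i).
have jE : j = i.+1 :> nat := ij.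
case fi: (arr_phi a i) => [l|]; case fj: (arr_phi a j) => [l'|].
- have pi := pi_fix fi; have pj := pi_fix fj.
  rewrite /letter fi fj /= pi pj /star /=.
  by case: (eqVneq (val l)) => /=; case: (eqVneq (val l')) => /=; lia.
- have pi := pi_fix fi; have nj := pi_nonfix fj.
  (* The fixed point [i] takes this value, so a deficiency at [j] lies below [i]. Symmetrically, in
     the next case an excedance at [i] lies above the fixed point [j]. *)
  have nji : arr_pi a j != i
    by rewrite -[X in _ != X]pi (inj_eq perm_inj) -val_eqE /=; lia.
  move: nj nji; rewrite -!val_eqE /letter fi fj /= pi /star /=.
  by case: (eqVneq (val l)) => /=; lia.
- have pj := pi_fix fj; have ni := pi_nonfix fi.
  have nij : arr_pi a i != j
    by rewrite -[X in _ != X]pj (inj_eq perm_inj) -val_eqE /=; lia.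
  move: ni nij; rewrite -!val_eqE /letter fi fj /= pj /star /=.
  by case: (eqVneq (val l')) => /=; lia.
have -> : des_gt (letter a i) (letter a j) = dez_gt (letter a i) (letter a j).
  by rewrite /letter fi fj.
by rewrite pos_gt_letter //; lia.
Qed.

Definition der (w : seq (tok k)) : seq nat :=
  [seq (odflt (0, false) p).1 | p <- posw w].

Lemma posw_cons (x : tok k) w :
  posw (x :: w) = if x is inr p then p :: posw w else posw w.
Proof. by case: x. Qed.

Lemma posw_word a :
  posw (word a)
  = [seq Some (index (arr_pi a i) (nonfix a), i < arr_pi a i) | i <- nonfix a].
Proof.
set f := fun i => _; rewrite /word [in RHS]/nonfix.
elim: (enum 'I_n) => // i s IH.
by rewrite map_cons posw_cons IH /= /letter; case: (arr_phi a i).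
Qed.

(** Hence Der depends only on the positive letters of the word. *)
Lemma Der_word a :
  Der_a a = [seq Posz (count (fun y => y <= x) (der (word a))) | x <- der (word a)].
Proof.
rewrite /Der_a /df Pos_redp.
have -> : Pos [seq if arr_phi a i is Some j then (- (Posz j.+1))%R
                   else Posz (arr_pi a i).+1 | i <- enum 'I_n]
          = [seq Posz (arr_pi a i).+1 | i <- nonfix a].
  rewrite /Pos /nonfix; elim: (enum 'I_n) => //= i s IH.
  by case: (arr_phi a i) => [l|] /=; rewrite IH.
rewrite redp_map // => [|]; last first.
  rewrite map_inj_uniq ?nonfix_uniq // => i j [] /eqP; rewrite val_eqE => /eqP.
  exact: perm_inj.
rewrite /der posw_word -!map_comp; apply/eq_in_map => i iP /=.
congr Posz; rewrite count_map; apply: eq_in_count => j jP /=.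
have nP l : l \in nonfix a -> arr_pi a l \in nonfix a.
  by rewrite mem_nonfix => /eqP; apply: pi_mem_nonfix.
by rewrite lez_nat ltnS leqNgt -(ltn_index_nonfix (nP _ iP) (nP _ jP)) -leqNgt.
Qed.

Lemma word_inj : injective word.
Proof.
move=> a b ab.
have letE i : letter a i = letter b i.
  by move/eq_in_map: ab => /(_ i); apply; rewrite mem_enum.
have phiE i : arr_phi a i = arr_phi b i.
  have := letE i; rewrite /letter.
  by case: (arr_phi a i) => [l|]; case: (arr_phi b i) => [l'|] // [->].
have nE : nonfix a = nonfix b by apply: eq_filter => i; rewrite phiE.
apply: val_inj; rewrite [val a]surjective_pairing [val b]surjective_pairing.
congr pair; last by apply/ffunP.
apply/permP => i; case fi: (arr_phi a i) => [l|].
  by rewrite [LHS](pi_fix fi) -[LHS](pi_fix (a := b) (l := l)) // -phiE.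
have fbi : arr_phi b i = None by rewrite -phiE.
have := letE i; rewrite /letter fi fbi nE => -[+ _].
move/(index_inj i); apply; first by rewrite -nE pi_mem_nonfix.
exact: pi_mem_nonfix.
Qed.

(** The derangement of [a] on its nonfixed points is carried to the positions of the positive
    letters of [w] by the increasing bijection, which preserves ranks and excedances. *)
Lemma word_surj a w : size w = n -> posw w = posw (word a) -> exists b, word b = w.
Proof.
move=> sw pw.
pose x0 : tok k := inr None.
pose P := [seq i : 'I_n <- enum 'I_n | if nth x0 w i is inr _ then true else false].
have uP : uniq P by rewrite filter_uniq ?enum_uniq.
have memP (i : 'I_n) : (i \in P) = if nth x0 w i is inr _ then true else false.
  by rewrite mem_filter mem_enum andbT.
have wE : w = [seq nth x0 w i | i : 'I_n <- enum 'I_n].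
  by rewrite -[LHS](mkseq_nth x0) sw /mkseq -val_enum_ord -map_comp.
have pwP : posw w = [seq (if nth x0 w i is inr p then p else None) | i : 'I_n <- P].
  rewrite {1}wE /P; elim: (enum 'I_n) => // i s IH.
  by rewrite map_cons posw_cons IH /=; case E: (nth x0 w i) => [l|p] //=; rewrite E.
have sP : size P = size (nonfix a).
  rewrite -(size_map (fun i : 'I_n => if nth x0 w i is inr p then p else None)).
  by rewrite -pwP pw posw_word size_map.
(* For [n = 0] there is no default ordinal, but both words are empty. *)
case: (posnP n) => [n0|npos].
  by exists a; apply/eqP; move: (size_word a) sw; rewrite n0 => /size0nil -> /size0nil ->.
pose i0 := Ordinal npos.
(* The derangement of [a], read on ranks. *)
pose d (q : nat) := index (arr_pi a (nth i0 (nonfix a) q)) (nonfix a).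
have nphi q : q < size P -> arr_phi a (nth i0 (nonfix a) q) = None.
  by rewrite sP => /(mem_nth i0); rewrite mem_nonfix => /eqP.
have dlt q : q < size P -> d q < size P.
  by move=> jP; rewrite /d [X in _ < X]sP index_mem pi_mem_nonfix // nphi.
have dinj q q' : q < size P -> q' < size P -> d q = d q' -> q = q'.
  move=> jP jP' /(index_inj i0 (pi_mem_nonfix (nphi _ jP)) (pi_mem_nonfix (nphi _ jP'))).
  by move=> /perm_inj /eqP; rewrite nth_uniq ?nonfix_uniq -?sP // => /eqP.
have dflag q : q < size P ->
    (nth i0 (nonfix a) q < arr_pi a (nth i0 (nonfix a) q)) = (q < d q).
  move=> jP; rewrite -(ltn_index_nonfix (a := a)) ?index_uniq ?nonfix_uniq -?sP //.
    by rewrite mem_nth -?sP.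
  by apply: pi_mem_nonfix; apply: nphi.
have dne q : q < size P -> d q != q.
  move=> jP; apply/eqP => dj; have /eqP := pi_nonfix (nphi _ jP); apply.
  by rewrite -[LHS](nth_index i0 (pi_mem_nonfix (nphi _ jP))) -/(d q) dj.
have wP i : i \in P -> nth x0 w i = inr (Some (d (index i P), index i P < d (index i P))).
  move=> iP; have jP : index i P < size P by rewrite index_mem.
  have := congr1 (fun s => nth None s (index i P)) pwP.
  rewrite pw posw_word !(nth_map i0) -?sP // -/(d _) dflag // nth_index //.
  by move: iP; rewrite memP; case: (nth x0 w i) => // p _ <-.
pose f i := if i \in P then nth i0 P (d (index i P)) else i.
have fP i : (f i \in P) = (i \in P).
  by rewrite /f; case: ifP => // iP; rewrite mem_nth // dlt // index_mem.
have finj : injective f.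
  move=> i j fij; have := fP i; rewrite fij fP; move: fij; rewrite /f.
  case: ifP => iP; case: ifP => jP // fij _.
  move: fij => /eqP; rewrite nth_uniq ?dlt ?index_mem // => /eqP /dinj.
  by rewrite !index_mem => /(_ iP jP) /(index_inj i0) ->.
pose g : {ffun 'I_n -> option 'I_k} :=
  [ffun i : 'I_n => if nth x0 w i is inl l then Some l else None].
have wf : arr_wf (perm finj, g).
  apply/forallP => i /=; rewrite permE ffunE /f memP.
  case: ifP (memP i) => [wi iP|wi iP]; last by case: (nth x0 w i) wi; rewrite ?eqxx.
  have jP : index i P < size P by rewrite index_mem.
  have -> : (nth i0 P (d (index i P)) == i) = false.
    by rewrite -{2}(nth_index i0 iP) nth_uniq ?dlt //; apply/negbTE/dne.
  by case: (nth x0 w i) wi.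
pose b : arrangement n k := exist _ (perm finj, g) wf.
have piE i : arr_pi b i = f i by rewrite /arr_pi /= permE.
have phE i : arr_phi b i = if nth x0 w i is inl l then Some l else None.
  by rewrite /arr_phi /= ffunE.
have nfE : nonfix b = P.
  by apply: eq_filter => i; rewrite phE; case: (nth x0 w i).
exists b; rewrite [RHS]wE; apply: eq_map => i.
rewrite /letter phE; case E: (nth x0 w i) => [l|p] //=.
have iP : i \in P by rewrite memP E.
have jP : index i P < size P by rewrite index_mem.
rewrite -E (wP i iP) piE nfE /f iP index_uniq ?dlt //.
congr (inr (Some (_, _))).
rewrite -{1}(nth_index i0 iP) -nfE -(ltn_index_nonfix (a := b)) nfE ?mem_nth ?dlt //.
by rewrite !index_uniq ?dlt.
Qed.

End Arr.

Theorem theorem1p2 (n k : nat) (hn : 1 <= n) (hk : 1 <= k)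
    (m : 'I_k -> nat) (tau : 'S_(k.-1)) :
  exists Psi : arrangement n k -> arrangement n k,
    [/\ (forall a, inA m a -> inA (mprime m tau) (Psi a)),
        (forall a b, inA m a -> inA m b -> Psi a = Psi b -> a = b),
        (forall b, inA (mprime m tau) b -> exists2 a, inA m a & Psi a = b) &
        (forall a, inA m a ->
           [/\ des_a a = dez_a (Psi a), dez_a a = des_a (Psi a)
             & Der_a a = Der_a (Psi a)])].
Proof.
have [F [[G FK GK] zF cF dF]] := swapping_bijection tau.
have mE i : mprime m tau i = m (relabel tau i).
  by rewrite /mprime /relabel; case: insub.
(* The default [a] is never reached, by [word_surj]. *)
pose Psi (a : arrangement n k) := odflt a [pick b | word b == F (word a)].
have PsiE a : word (Psi a) = F (word a).
  rewrite /Psi; case: pickP => [b /eqP //|none].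
  have [zw pw] := zF (word a); rewrite size_word in zw.
  have [b Eb] := word_surj zw pw.
  by have := none b; rewrite Eb eqxx.
have cPsi a i : fixcnt (Psi a) i = fixcnt a (relabel tau i).
  by rewrite !fixcnt_word PsiE cF.
exists Psi; split.
- by move=> a am i; rewrite cPsi mE.
- move=> a b _ _ ab; apply: word_inj; apply: (can_inj FK).
  by rewrite -!PsiE ab.
- move=> b bm.
  (* [G (word b)] has the size and positive letters of its image [word b] under [F], hence is the
     word of an arrangement. *)
  have [zw pw] := zF (G (word b)); rewrite GK size_word in zw pw.
  have [a Ea] := word_surj (esym zw) (esym pw).
  have Pa : Psi a = b by apply: word_inj; rewrite PsiE Ea GK.
  exists a => // i.
  (* Relabelling is onto, so the contents of [b] determine all those of [a]. *)
  have -> : i = relabel tau (relabel tau^-1%g i).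
    by rewrite -relabelM mulVg relabel1.
  by rewrite -cPsi -mE Pa.
move=> a _; have [dez des] := dF (word a).
split.
- by rewrite des_word dez_word PsiE dez.
- by rewrite dez_word des_word PsiE des.
by rewrite !Der_word /der PsiE (zF (word a)).2.
Qed.
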